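(* Let $L$ be a Fréchet module over a Banach $k$-algebra $A$ which has a (left) bounded approximate unit in $A$, bounded by a number $d>0$. Then for every $z\in L$ and $\varepsilon>0$ there exist elements $\sigma\in A$ and $y\in L$ such that: (i) $z=\sigma y$; (ii) $y\in\overline{A\cdot z}$ (closure in $L$); (iii) $\rho(y;z)\le\varepsilon$; (iv) $\|\sigma\|\le d$.
   Context: $k=\mathbb{R}$ or $\mathbb{C}$; algebras are associative and not necessarily unital. A Fréchet module over a Banach $k$-algebra $A$ is a left $A$-module $L$ with a $k$-linear structure satisfying $(t\mu)x=t(\mu x)=\mu(tx)$ ($t\in k,\mu\in A,x\in L$) which is a Fréchet space whose topology is given by an increasing sequence of seminorms $\{\|\cdot\|_n\}_{n\geq 1}$ for which there is a number $C\ge1$, independent of $n$, such that for every $n$ there is a seminorm $\|\cdot\|_{m(n)}$ with $\|\mu x\|_n\le C\|\mu\|\,\|x\|_{m(n)}$ for all $\mu\in A$, $x\in L$. The metric on $L$ is $\rho(x;y)=\sum_{n=1}^\infty 2^{-n}\frac{\|x-y\|_n}{1+\|x-y\|_n}$. $L$ possesses a left bounded approximate unit in $A$, bounded by $d>0$, if for every finite subset $\{\mu_1,\dots,\mu_m\}\subset A$, every $x\in L$ and every $\varepsilon>0$ there is $\nu\in A$ with $\|\nu\|\le d$, $\|\nu\mu_i-\mu_i\|<\varepsilon$ for all $i$, and $\rho(\nu x;x)<\varepsilon$. *)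

(* Defs.v *)
From HB Require Import structures.
From mathcomp Require Import all_boot all_order all_algebra.
From mathcomp Require Import sesquilinear complex.
From mathcomp Require Import all_classical all_reals all_analysis.

Set Implicit Arguments.
Unset Strict Implicit.
Unset Printing Implicit Defensive.

Import Order.TTheory GRing.Theory Num.Theory.
Import numFieldTopology.Exports numFieldNormedType.Exports.

Local Open Scope classical_set_scope.
Local Open Scope ring_scope.

Variant scalar_kind := RealScalars | ComplexScalars.

Definition scalars (R : realType) (s : scalar_kind) : numFieldType :=
  match s with
  | RealScalars => R
  | ComplexScalars => R[i]%C
  end.

Definition real_part (R : realType) (s : scalar_kind) : scalars R s -> R :=
  match s return scalars R s -> R with
  | RealScalars => fun t => t
  | ComplexScalars => fun t => complex.Re t
  end.

(* A norm over the scalar field k takes its values in k itself (in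
   the nonnegative reals inside k); [rnorm] is the same norm, valued in R. *)
Definition rnorm (R : realType) (s : scalar_kind)
    (V : normedZmodType (scalars R s)) (x : V) : R :=
  real_part `|x|.

(* Algebras in [ssralg] are unital, so the product of a Banach algebra, which
   need not have a unit, is a bilinear map on a Banach space. *)
Record banach_algebra (R : realType) (s : scalar_kind)
    (A : completeNormedModType (scalars R s))
    (mul : {bilinear A -> A -> A}) : Prop := BanachAlgebra {
  banach_mulA : associative mul ;
  banach_norm_mul : forall a b : A, rnorm (mul a b) <= rnorm a * rnorm b
}.

Record seminorm (R : realType) (s : scalar_kind) (L : lmodType (scalars R s))
    (q : L -> R) : Prop := Seminorm {
  seminormD : forall x y : L, q (x + y) <= q x + q y ;
  seminormZ : forall (t : scalars R s) (x : L), q (t *: x) = rnorm t * q x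
}.

(* [p n] is the seminorm with index n + 1 of the sequence indexed from 1. Since
   the sequence is increasing, the balls of single seminorms already form a
   basis of neighbourhoods. Completeness refers to the uniform structure of the
   topological group L; since the topology is given by countably many
   seminorms, Cauchy sequences suffice. *)
Record frechet_space (R : realType) (s : scalar_kind)
    (L : topologicalLmodType (scalars R s)) (p : nat -> L -> R) : Prop :=
    FrechetSpace {
  frechet_seminorm : forall n, seminorm (p n) ;
  frechet_increasing : forall x : L, nondecreasing_seq (p ^~ x) ;
  frechet_nbhs : forall (x : L) (U : set L),
    nbhs x U <->
    exists n, exists2 e : R, 0 < e & [set y | p n (x - y) < e] `<=` U ;
  frechet_hausdorff : hausdorff_space L ;
  frechet_complete : forall u : nat -> L,
    (forall U : set L, nbhs 0 U ->
      exists N, forall i j, (N <= i)%N -> (N <= j)%N -> U (u i - u j)) ->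
    exists l : L, u @ \oo --> l
}.

Record frechet_module (R : realType) (s : scalar_kind)
    (A : completeNormedModType (scalars R s)) (mul : {bilinear A -> A -> A})
    (L : topologicalLmodType (scalars R s)) (act : {bilinear A -> L -> L})
    (p : nat -> L -> R) : Prop := FrechetModule {
  frechet_module_space : frechet_space p ;
  frechet_module_actA : forall (a b : A) (x : L),
    act (mul a b) x = act a (act b x) ;
  frechet_module_bound : exists2 C : R, 1 <= C &
    forall n, exists m, forall (a : A) (x : L),
      p n (act a x) <= C * rnorm a * p m x
}.

Definition frechet_dist (R : realType) (L : zmodType) (p : nat -> L -> R)
    (x y : L) : R :=
  limn (series (fun n => 2 ^- n.+1 * (p n (x - y) / (1 + p n (x - y))))).

Definition left_bounded_approximate_unit (R : realType) (s : scalar_kind)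
    (A : completeNormedModType (scalars R s)) (mul : {bilinear A -> A -> A})
    (L : topologicalLmodType (scalars R s)) (act : {bilinear A -> L -> L})
    (p : nat -> L -> R) (d : R) : Prop :=
  forall (ms : seq A) (x : L) (e : R), 0 < e ->
  exists nu : A,
    [/\ rnorm nu <= d,
        forall m : A, m \in ms -> rnorm (mul nu m - m) < e
      & frechet_dist p (act nu x) x < e].

(* Main.v *)
Require Import Defs.
From HB Require Import structures.
From mathcomp Require Import all_boot all_order all_algebra.
From mathcomp Require Import sesquilinear complex ring lra.
From mathcomp Require Import all_classical all_reals all_analysis.

Set Implicit Arguments.
Unset Strict Implicit.
Unset Printing Implicit Defensive.

Import Order.TTheory GRing.Theory Num.Theory.
Import numFieldTopology.Exports numFieldNormedType.Exports.

Local Open Scope classical_set_scope.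
Local Open Scope ring_scope.

(** This is Cohen's factorization argument. In the unitization [k * A] put
    [t_n = (1-c)^n + a_n] with [a_n = \sum_(j < n) c (1-c)^j e_j], where the
    [e_j], of norm at most [d], are chosen one at a time from the approximate
    unit. Since the weights [c (1-c)^j] add up to 1, the [a_n] converge to some
    [sigma] with [rnorm sigma <= d], and the scalar part of [t_n] tends to 0. If
    every [t_n] is invertible and [y_n = t_n^-1 z] is Cauchy with limit [y], then
    [z = t_n y_n] gives [z = sigma y] in the limit. Each [y_n] lies in the
    closure of [A z], because [z] does, so the same holds for [y]; and [y] is as
    close to [z = y_0] as the successive differences are small.

    The work is in the passage from [t_n] to [t_(n+1)] ([cohen_step]). Put
    [E = (1-c) + c e] with [e = e_n]. For [c] small compared with [1/d] it is a
    multiple of a small perturbation of 1, hence has an inverse [F], and the size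
    of [F] has a bound independent of [e] ([cohen_factor_inverse]). If [e] almost
    fixes an element, so does [F], since [F x - x = c F (x - e x)]
    ([cohen_factor_inverse_sub]). Now [t_(n+1) = E (t_n + delta)] where
    [delta = F a_n - a_n] is as small as desired, and
    [t_n + delta = t_n (1 + t_n^-1 delta)] is inverted by inverting a small
    perturbation of 1 ([quasi_inverse]). The resulting inverse of [t_(n+1)] sends
    [z] near [t_n^-1 z] because both [F z - z] and [delta] are small. Of
    the inverse of [t_n] only the identity [t_n t_n^-1 = 1] is used and carried
    along.

    An element of the unitization acts on [L] with bounds
    [p n (u x) <= C |u| p m x] in which [m] depends only on [n]
    ([frechet_uact_bound]): a Neumann series acts through its sum in [A], so
    the loss of seminorm index occurs once and does not accumulate along the
    powers. *)

(** * Scalars, norms and seminorms *)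

(** Norms live in the scalar field, while all estimates are made in [R]; this
    embedding transports the ordered field structure from one to the other. *)
Definition of_real (R : realType) (s : scalar_kind) : R -> scalars R s :=
  match s return R -> scalars R s with
  | RealScalars => fun t => t
  | ComplexScalars => real_complex R
  end.
Arguments of_real {R} s.

Lemma of_realD (R : realType) s (x y : R) :
  of_real s (x + y) = of_real s x + of_real s y.
Proof. by case: s => //=; rewrite rmorphD. Qed.

Lemma of_realM (R : realType) s (x y : R) :
  of_real s (x * y) = of_real s x * of_real s y.
Proof. by case: s => //=; rewrite rmorphM. Qed.

Lemma of_real1 (R : realType) s : of_real s (1 : R) = 1.
Proof. by case: s. Qed.

Lemma of_real0 (R : realType) s : of_real s (0 : R) = 0.
Proof. by case: s. Qed.

Lemma of_realN (R : realType) s (x : R) : of_real s (- x) = - of_real s x.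
Proof. by apply/eqP; rewrite -addr_eq0 -of_realD addNr of_real0. Qed.

Lemma of_real_le (R : realType) s (x y : R) :
  (of_real s x <= of_real s y) = (x <= y).
Proof. by case: s => //=; rewrite lecR. Qed.

Lemma of_real_lt (R : realType) s (x y : R) :
  (of_real s x < of_real s y) = (x < y).
Proof. by case: s => //=; rewrite ltcR. Qed.

Lemma real_partK (R : realType) s (t : scalars R s) :
  0 <= t -> of_real s (real_part t) = t.
Proof. by case: s t => //= -[a b] /=; rewrite lecE /= => /andP[/eqP -> _]. Qed.

Lemma normE (R : realType) s (V : normedZmodType (scalars R s)) (x : V) :
  `|x| = of_real s (rnorm x).
Proof. by rewrite /rnorm real_partK. Qed.

Lemma rnorm_of_real (R : realType) s (x : R) :
  0 <= x -> rnorm (of_real s x) = x.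
Proof.
move=> x0; apply/le_anti; rewrite -!(of_real_le s) -!normE.
by rewrite ger0_norm ?lexx// -(of_real0 R s) of_real_le.
Qed.

Lemma rnorm_ge0 (R : realType) s (V : normedZmodType (scalars R s)) (x : V) :
  0 <= rnorm x.
Proof. by rewrite -(of_real_le s) -normE of_real0. Qed.

Lemma rnormM (R : realType) s (t t' : scalars R s) :
  rnorm (t * t') = rnorm t * rnorm t'.
Proof.
by apply/le_anti; rewrite -!(of_real_le s) !of_realM -!normE normrM lexx.
Qed.

Lemma rnorm_eq0 (R : realType) s (V : normedZmodType (scalars R s)) (x : V) :
  rnorm x <= 0 -> x = 0.
Proof. by rewrite -(of_real_le s) -normE of_real0 normr_le0 => /eqP. Qed.

Lemma rnorm_seminorm (R : realType) s (V : normedModType (scalars R s)) :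
  seminorm (@rnorm R s V).
Proof.
split=> [x y|t x].
  by rewrite -(of_real_le s) of_realD -!normE ler_normD.
by apply/le_anti; rewrite -!(of_real_le s) !of_realM -!normE normrZ lexx.
Qed.

Lemma seminorm0 (R : realType) s (L : lmodType (scalars R s)) (q : L -> R) :
  seminorm q -> q 0 = 0.
Proof.
move=> hq; rewrite -(scale0r 0) (seminormZ hq) -(of_real0 R s).
by rewrite rnorm_of_real// mul0r.
Qed.

Lemma seminormN (R : realType) s (L : lmodType (scalars R s)) (q : L -> R) :
  seminorm q -> forall x, q (- x) = q x.
Proof.
move=> hq x; rewrite -scaleN1r (seminormZ hq) [rnorm _]/rnorm normrN1.
by rewrite -(of_real1 R s) (_ : real_part _ = 1) ?mul1r//; case: (s).
Qed.

Lemma seminorm_ge0 (R : realType) s (L : lmodType (scalars R s)) (q : L -> R) :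
  seminorm q -> forall x, 0 <= q x.
Proof.
move=> hq x; have := seminormD hq x (- x).
by rewrite subrr (seminorm0 hq) (seminormN hq) -mulr2n pmulrn_lge0.
Qed.

(** The bound is needed only from the index [N] on: the [n]-th seminorm of a
    Fréchet space controls the increments of the sequences built below only
    after finitely many terms. *)
Lemma seminorm_telescope (R : realType) s (L : lmodType (scalars R s))
    (q : L -> R) (u : nat -> L) (K r : R) (N : nat) :
  seminorm q -> 0 <= K -> 0 <= r < 1 ->
  (forall n, (N <= n)%N -> q (u n.+1 - u n) <= K * r ^+ n) ->
  forall i j, (N <= i <= j)%N -> q (u j - u i) <= K * r ^+ i / (1 - r).
Proof.
move=> hq K0 /andP[r0 r1] hu i j /andP[Ni /subnKC <-].
have r1' : 0 < 1 - r by rewrite subr_gt0.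
(* The exact geometric sum is what the induction on [j - i] preserves. *)
apply: (@le_trans _ _ (K * r ^+ i * (1 - r ^+ (j - i)) / (1 - r))); last first.
  rewrite ler_pM2r ?invr_gt0// ler_piMr ?mulr_ge0 ?exprn_ge0//.
  by rewrite gerBl exprn_ge0.
elim: (j - i)%N => [|k IH].
  by rewrite addn0 subrr (seminorm0 hq) expr0 subrr mulr0 mul0r.
rewrite (_ : _ - _ = (u (i + k).+1 - u (i + k)) + (u (i + k) - u i)); last first.
  by rewrite addnS addrA subrK.
apply: le_trans (seminormD hq _ _) _.
have := lerD (hu (i + k)%N (leq_trans Ni (leq_addr _ _))) IH.
move=> /le_trans; apply; rewrite exprD exprS.
by rewrite le_eqVlt; apply/orP; left; apply/eqP; field; rewrite gt_eqF.
Qed.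

Lemma rnorm_complete (R : realType) s (A : completeNormedModType (scalars R s))
    (u : nat -> A) :
  (forall e : R, 0 < e -> exists N, forall i j, (N <= i)%N -> (N <= j)%N ->
     rnorm (u i - u j) < e) ->
  exists l : A, forall e : R, 0 < e ->
    \forall n \near \oo, rnorm (u n - l) < e.
Proof.
move=> hu; have cu : cvg (u @ \oo).
  apply/cauchy_cvgP/cauchy_ballP => e e0.
  have e1 : 0 < real_part e by rewrite -(of_real_lt s) of_real0 real_partK// ltW.
  have [N hN] := hu _ e1; near_simpl.
  exists ([set n | (N <= n)%N], [set n | (N <= n)%N]).
    by split; exists N.
  move=> [i j] [/= Ni Nj]; rewrite -ball_normE /= normE -(real_partK (ltW e0)).
  by rewrite of_real_lt; exact: hN.
exists (lim (u @ \oo)) => e e0.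
have e1 : 0 < of_real s e by rewrite -(of_real0 R s) of_real_lt.
have /cvgrPdist_lt/(_ _ e1) := cu.
apply: filterS => n.
by rewrite normE of_real_lt -(seminormN (rnorm_seminorm A)) opprB.
Qed.

Lemma geometric_lt (R : realType) (K r e : R) :
  0 <= r < 1 -> 0 < e -> \forall n \near \oo, K * r ^+ n < e.
Proof.
move=> /andP[r0 r1] e0.
have /cvgrPdist_lt/(_ _ e0) : geometric K r @ \oo --> 0.
  by apply: cvg_geometric; rewrite ger0_norm.
apply: filterS => n; rewrite sub0r normrN; exact: le_lt_trans (ler_norm _).
Qed.

Lemma rnorm_geometric_cvg (R : realType) s
    (A : completeNormedModType (scalars R s)) (u : nat -> A) (K r : R) :
  0 <= K -> 0 <= r < 1 ->
  (forall n, rnorm (u n.+1 - u n) <= K * r ^+ n) ->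
  exists l : A, forall e : R, 0 < e ->
    \forall n \near \oo, rnorm (u n - l) < e.
Proof.
move=> K0 r01 hu; apply: rnorm_complete => e e0.
have [N _ hN] := geometric_lt (K / (1 - r)) r01 e0.
exists N => i j; wlog ij : i j / (i <= j)%N => [W|] Ni Nj.
  have [/W|/ltnW/W] := leqP i j; first exact.
  by move=> /(_ Nj Ni); rewrite -(seminormN (rnorm_seminorm A)) opprB.
rewrite -(seminormN (rnorm_seminorm A)) opprB.
apply: le_lt_trans (hN _ Ni) => /=; rewrite mulrAC.
exact: (seminorm_telescope (N := 0) (rnorm_seminorm A)).
Qed.

(** * The unitization of an algebra *)

(** The product comes from [umul] below. The associativity proof is a parameter
    of the type so that the ring structure can be attached to it. *)
Definition unitization (k : comNzRingType) (A : lmodType k)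
  (mul : {bilinear A -> A -> A}) (mulA : associative mul) : Type :=
  (k * A)%type.

Definition uact (k : comNzRingType) (A V : lmodType k)
    (act : {bilinear A -> V -> V}) (u : k * A) (x : V) : V :=
  u.1 *: x + act u.2 x.

Definition umul (k : comNzRingType) (A : lmodType k)
    (mul : {bilinear A -> A -> A}) (u v : k * A) : k * A :=
  (u.1 * v.1, uact mul u v.2 + v.1 *: u.2).

Lemma uactD (k : comNzRingType) (A V : lmodType k)
    (act : {bilinear A -> V -> V}) (u v : k * A) (x : V) :
  uact act (u + v) x = uact act u x + uact act v x.
Proof. by rewrite /uact /= scalerDl linearDl /= addrACA. Qed.

Lemma uactDr (k : comNzRingType) (A V : lmodType k)
    (act : {bilinear A -> V -> V}) (u : k * A) (x y : V) :
  uact act u (x + y) = uact act u x + uact act u y.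
Proof. by rewrite /uact scalerDr linearDr /= addrACA. Qed.

Lemma uactZr (k : comNzRingType) (A V : lmodType k)
    (act : {bilinear A -> V -> V}) (u : k * A) (t : k) (x : V) :
  uact act u (t *: x) = t *: uact act u x.
Proof. by rewrite /uact linearZr /= scalerDr !scalerA mulrC. Qed.

Lemma uactBr (k : comNzRingType) (A V : lmodType k)
    (act : {bilinear A -> V -> V}) (u : k * A) (x y : V) :
  uact act u (x - y) = uact act u x - uact act u y.
Proof. by rewrite uactDr -scaleN1r uactZr scaleN1r. Qed.

Lemma uact1 (k : comNzRingType) (A V : lmodType k)
    (act : {bilinear A -> V -> V}) (x : V) : uact act (1, 0) x = x.
Proof. by rewrite /uact /= scale1r linear0l addr0. Qed.

Lemma uact_umul (k : comNzRingType) (A V : lmodType k)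
    (mul : {bilinear A -> A -> A}) (act : {bilinear A -> V -> V})
    (actA : forall a b x, act (mul a b) x = act a (act b x))
    (u v : k * A) (x : V) :
  uact act (umul mul u v) x = uact act u (uact act v x).
Proof.
rewrite /uact /= !linearDl linearDr /= !linearZl_LR linearZr /=.
by rewrite actA scalerDr scalerA -!addrA; congr (_ + (_ + _)); rewrite addrC.
Qed.

Lemma umulE (k : comNzRingType) (A : lmodType k)
    (mul : {bilinear A -> A -> A}) (u v : k * A) :
  umul mul u v = (u.1 * v.1, uact mul u v.2 + v.1 *: u.2).
Proof. by []. Qed.

Section Unitization.
Context (k : comNzRingType) (A : lmodType k) (mul : {bilinear A -> A -> A}).
Context (mulA : associative mul).
Local Notation U := (unitization mulA).

HB.instance Definition _ := GRing.Zmodule.copy U (k * A)%type.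

Let mulU (u v : U) : U := umul mul u v.

Fact umulA : associative mulU.
Proof.
move=> u v w; rewrite /mulU [umul _ u (umul _ v w)]umulE.
rewrite [umul mul (umul mul u v) w]umulE /=; congr (_, _).
  by rewrite mulrA.
rewrite (uact_umul (fun a b x => esym (mulA a b x))) uactDr uactZr -addrA.
by rewrite (scalerDr w.1 (uact mul u v.2)) scalerA [w.1 * _]mulrC.
Qed.

Fact umul1l : left_id ((1, 0) : U) mulU.
Proof. by case=> a b; rewrite /mulU umulE uact1 scaler0 addr0 mul1r. Qed.

Fact umul1r : right_id ((1, 0) : U) mulU.
Proof.
by case=> a b; rewrite /mulU umulE /= scale1r mulr1 /uact linear0r scaler0 !add0r.
Qed.

Fact umulDl : left_distributive mulU +%R.
Proof.
by move=> u v w; rewrite /mulU umulE uactD /= mulrDl scalerDr addrACA.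
Qed.

Fact umulDr : right_distributive mulU +%R.
Proof.
by move=> u v w; rewrite /mulU umulE uactDr /= mulrDr scalerDl addrACA.
Qed.

Fact u1_neq0 : ((1, 0) : U) != 0.
Proof. by apply/eqP => -[/eqP]; rewrite oner_eq0. Qed.

HB.instance Definition _ :=
  GRing.Zmodule_isNzRing.Build U umulA umul1l umul1r umulDl umulDr u1_neq0.

End Unitization.

Lemma unitization_mulE (k : comNzRingType) (A : lmodType k)
    (mul : {bilinear A -> A -> A}) (mulA : associative mul)
    (u v : unitization mulA) :
  u * v = (u.1 * v.1, uact mul u v.2 + v.1 *: u.2) :> unitization mulA.
Proof. by []. Qed.

Lemma uactM (k : comNzRingType) (A V : lmodType k)
    (mul : {bilinear A -> A -> A}) (mulA : associative mul)
    (act : {bilinear A -> V -> V})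
    (actA : forall a b x, act (mul a b) x = act a (act b x))
    (u v : unitization mulA) (x : V) :
  uact act (u * v) x = uact act u (uact act v x).
Proof. exact: uact_umul. Qed.

(** * Fréchet spaces *)

(** The terms before [N] are at most [2 ^- n.+1 * q N] because [q] increases,
    and the others at most [2 ^- n.+1]. *)
Lemma series_ratio_le (R : realType) (q : nat -> R) (N M : nat) :
  (forall n, 0 <= q n) -> nondecreasing_seq q ->
  series (fun n => 2 ^- n.+1 * (q n / (1 + q n))) M <= q N + 2 ^- N.
Proof.
move=> q0 qi; set f := fun n => _.
have e0 n : 0 < 2 ^- n :> R by rewrite invr_gt0 exprn_gt0.
have eS n : 2 ^- n = 2 ^- n.+1 + 2 ^- n.+1 :> R.
  by rewrite exprS invfM -mulrDl; field; rewrite expf_neq0.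
have f_le n : f n <= 2 ^- n.+1 * q n.
  rewrite ler_pM2l// ler_pdivrMr ?ltr_pwDl// ler_peMr//.
  by rewrite lerDl.
have f_le1 n : f n <= 2 ^- n.+1.
  by rewrite -[leRHS]mulr1 ler_pM2l// ler_pdivrMr ?ltr_pwDl// mul1r lerDr.
have head m : (m <= N)%N -> series f m <= q N * (1 - 2 ^- m).
  elim: m => [|m IH] mN; first by rewrite seriesEnat/= big_geq// expr0 invr1 subrr mulr0.
  rewrite seriesSr.
  apply: le_trans (lerD (IH (ltnW mN)) (f_le m)) _.
  have := qi _ _ (ltnW mN); rewrite -(ler_pM2l (e0 m.+1)) => h.
  apply: le_trans (lerD (lexx _) h) _.
  by rewrite (eS m) le_eqVlt; apply/orP; left; apply/eqP; ring.
have [MN|NM] := leqP M N.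
  apply: le_trans (head _ MN) _; rewrite mulrBr mulr1 lerD2l.
  by apply: (@le_trans _ _ 0); [rewrite oppr_le0 mulr_ge0// ltW|exact: ltW].
rewrite -(subnKC (ltnW NM)).
suff: series f (N + (M - N))%N <= q N + 2 ^- N - 2 ^- (N + (M - N))%N.
  by move/le_trans; apply; rewrite gerBl ltW.
elim: (M - N)%N => [|j IH].
  rewrite addn0 addrK; apply: le_trans (head _ (leqnn _)) _.
  by rewrite ler_piMr// gerBl ltW.
rewrite addnS seriesSr; apply: le_trans (lerD IH (f_le1 _)) _.
by rewrite (eS (N + j)%N) -addrA lerD2l; lra.
Qed.

Lemma series_ratio_nondecreasing (R : realType) (q : nat -> R) :
  (forall n, 0 <= q n) ->
  nondecreasing_seq (series (fun n => 2 ^- n.+1 * (q n / (1 + q n)))).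
Proof.
move=> q0; apply/nondecreasing_seqP => n; rewrite seriesSr lerDl.
by rewrite mulr_ge0// ?invr_ge0 ?exprn_ge0// divr_ge0// addr_ge0.
Qed.

Section Distance.
Context (R : realType) (s : scalar_kind).
Context (L : topologicalLmodType (scalars R s)).
Context (p : nat -> L -> R) (hp : frechet_space p).

Let p0 n x : 0 <= p n x.
Proof. exact: seminorm_ge0 (frechet_seminorm hp n) x. Qed.

Let dist_cvg x y :
  cvgn (series (fun n => 2 ^- n.+1 * (p n (x - y) / (1 + p n (x - y))))).
Proof.
apply: nondecreasing_is_cvgn; first exact: series_ratio_nondecreasing.
exists (p 0 (x - y) + 2 ^- 0) => _ [M _ <-].
exact: series_ratio_le (frechet_increasing hp (x - y)).
Qed.

Lemma frechet_dist_le x y N : frechet_dist p x y <= p N (x - y) + 2 ^- N.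
Proof.
apply: limr_le; first exact: dist_cvg.
apply: nearW => M; exact: series_ratio_le (frechet_increasing hp (x - y)).
Qed.

(** A single term of the series already detects the seminorm of index [N],
    because [t / (1 + t)] increases with [t]. *)
Lemma frechet_dist_controls N (e : R) : 0 < e ->
  exists2 r : R, 0 < r & forall x y, frechet_dist p x y < r -> p N (x - y) < e.
Proof.
move=> e0; have e1 : 0 < 1 + e by rewrite addr_gt0.
exists (2 ^- N.+1 * (e / (1 + e))).
  by rewrite mulr_gt0// ?invr_gt0 ?exprn_gt0// divr_gt0.
move=> x y; set q := p N (x - y) => xy.
have q0 : 0 <= q := p0 N (x - y).
have q1 : 0 < 1 + q by rewrite ltr_pwDl.
have : 2 ^- N.+1 * (q / (1 + q)) < 2 ^- N.+1 * (e / (1 + e)).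
  apply: le_lt_trans xy.
  pose f n : R := 2 ^- n.+1 * (p n (x - y) / (1 + p n (x - y))).
  have fi : nondecreasing_seq (series f) by exact: series_ratio_nondecreasing.
  have lim_ge : series f N.+1 <= frechet_dist p x y.
    exact: (nondecreasing_cvgn_le fi (@dist_cvg x y) N.+1).
  apply: le_trans lim_ge.
  rewrite seriesSr lerDr -[leLHS](_ : series f 0 = 0).
    exact: fi.
  by rewrite seriesEnat/= big_geq.
rewrite ltr_pM2l ?invr_gt0 ?exprn_gt0// ltr_pdivrMr// mulrAC ltr_pdivlMr//.
by rewrite mulrDr mulr1 mulrDr mulr1 [e * q]mulrC ltrD2r.
Qed.

Lemma frechet_eq0 x : (forall n, p n x = 0) -> x = 0.
Proof.
move=> px; apply: (frechet_hausdorff hp) => B B' xB.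
move=> /(frechet_nbhs hp) [n [e e0 sB]]; exists x; split.
  exact: nbhs_singleton xB.
by apply: sB; rewrite /= sub0r (seminormN (frechet_seminorm hp n)) px.
Qed.

(** Letting the seminorm index grow with the term makes the sequence Cauchy for
    every seminorm, while the displacement of the limit from [u 0] is still
    controlled by the seminorm of index [N]. *)
Lemma frechet_geometric_cvg (u : nat -> L) (K r : R) (N : nat) :
  0 <= K -> 0 <= r < 1 ->
  (forall n, p (N + n) (u n.+1 - u n) <= K * r ^+ n) ->
  exists2 y : L, p N (y - u 0) <= K / (1 - r) &
    forall n e, 0 < e -> \forall k \near \oo, p n (u k - y) < e.
Proof.
move=> K0 r01 hu; have hs := frechet_seminorm hp.
have tele n i j : (n - N <= i <= j)%N ->
    p n (u j - u i) <= K * r ^+ i / (1 - r).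
  apply: (seminorm_telescope (hs n)) => // k nNk.
  apply: le_trans (hu k); apply: (frechet_increasing hp).
  by rewrite -leq_subLR.
have [y uy] : exists y : L, u @ \oo --> y.
  apply: (frechet_complete hp) => U /(frechet_nbhs hp) [n [e e0 sU]].
  have [M _ hM] := geometric_lt (K / (1 - r)) r01 e0.
  exists (maxn M (n - N)) => i j; rewrite !geq_max => /andP[Mi ni] /andP[Mj nj].
  apply: sU; rewrite /= sub0r opprB.
  have [ij|/ltnW ji] := leqP i j.
    apply: le_lt_trans (tele _ _ _ _) _; first by rewrite ni ij.
    by rewrite mulrAC; exact: hM.
  rewrite -(seminormN (hs n)) opprB.
  apply: le_lt_trans (tele _ _ _ _) _; first by rewrite nj ji.
  by rewrite mulrAC; exact: hM.
have cvg_p n e : 0 < e -> \forall k \near \oo, p n (u k - y) < e.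
  move=> e0; apply: (uy [set x | p n (x - y) < e]); apply/(frechet_nbhs hp); exists n.
  exists e => // x /=.
  by rewrite -(seminormN (hs n)) opprB.
exists y => //; apply/ler_addgt0Pr => e e0.
have [k _ /(_ k (leqnn _)) hk] := cvg_p N e e0.
rewrite (_ : y - u 0 = (y - u k) + (u k - u 0)); last by rewrite addrA subrK.
apply: le_trans (seminormD (hs N) _ _) _; rewrite addrC lerD//.
  by have := @tele N 0 k; rewrite expr0 mulr1 subnn; apply.
by rewrite -(seminormN (hs N)) opprB ltW.
Qed.

End Distance.

(** * Inverses in the unitization of a Banach algebra *)

Definition usize (R : realType) (s : scalar_kind)
    (A : normedModType (scalars R s)) (u : scalars R s * A) : R :=
  rnorm u.1 + rnorm u.2.

Lemma usize_ge0 (R : realType) s (A : normedModType (scalars R s))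
    (u : scalars R s * A) : 0 <= usize u.
Proof. by rewrite addr_ge0// rnorm_ge0. Qed.

Lemma seminorm_uact (R : realType) s (A : normedModType (scalars R s))
    (V : lmodType (scalars R s)) (act : {bilinear A -> V -> V})
    (q q' : V -> R) (C : R) :
  seminorm q -> 1 <= C -> (forall x, q x <= q' x) ->
  (forall a x, q (act a x) <= C * rnorm a * q' x) ->
  forall u x, q (uact act u x) <= C * usize u * q' x.
Proof.
move=> hq C1 qq' hact u x; apply: le_trans (seminormD hq _ _) _.
rewrite (seminormZ hq) /usize mulrDr mulrDl lerD ?hact// -mulrA.
have x0 : 0 <= rnorm u.1 * q' x.
  by rewrite mulr_ge0 ?rnorm_ge0// (le_trans (seminorm_ge0 hq x)).
apply: (@le_trans _ _ (rnorm u.1 * q' x)); last by rewrite ler_peMl.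
by rewrite ler_wpM2l ?rnorm_ge0.
Qed.

Section BanachAlgebra.
Context (R : realType) (s : scalar_kind).
Context (A : completeNormedModType (scalars R s)).
Context (mul : {bilinear A -> A -> A}) (hA : banach_algebra mul).
Local Notation U := (unitization (banach_mulA hA)).

Lemma rnorm_uact u x : rnorm (uact mul u x) <= usize u * rnorm x.
Proof.
rewrite -[usize u]mul1r; apply: seminorm_uact => //; first exact: rnorm_seminorm.
by move=> a b; rewrite mul1r; exact: banach_norm_mul.
Qed.

Lemma usizeM (u v : U) : usize (u * v) <= usize u * usize v.
Proof.
rewrite unitization_mulE {1}/usize /= rnormM.
have := seminormD (rnorm_seminorm A) (uact mul u v.2) (v.1 *: u.2).
have := rnorm_uact u v.2.
rewrite !(seminormZ (rnorm_seminorm _)) /usize; nra.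
Qed.

(** [g] is the sum of the Neumann series of [(1 + a)^-1 - 1], obtained as the
    fixed point of the contraction [x |-> - (a + a x)]. It belongs to [A] itself,
    which is why completeness of [A] suffices. *)
Lemma quasi_inverse (a : A) : rnorm a <= 2^-1 ->
  exists g : A, [/\ ((1, a) : U) * ((1, g) : U) = 1,
    ((1, g) : U) * ((1, a) : U) = 1 & rnorm g <= 2 * rnorm a].
Proof.
move=> a2; have hs := rnorm_seminorm A; have a0 := rnorm_ge0 a.
pose T x := - (a + mul a x).
have TB x y : T x - T y = mul a (y - x).
  by rewrite /T linearBr /= opprK opprD addrACA addNr add0r addrC.
have Tlip x y : rnorm (T x - T y) <= 2^-1 * rnorm (x - y).
  rewrite TB -(seminormN hs (x - y)) opprB.
  apply: le_trans (banach_norm_mul hA _ _) _.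
  by rewrite ler_wpM2r// rnorm_ge0.
pose u n := iter n T 0.
have r01 : 0 <= (2^-1 : R) < 1 by apply/andP; split; lra.
have du n : rnorm (u n.+1 - u n) <= rnorm a * 2^-1 ^+ n.
  elim: n => [|n IH].
    by rewrite /u/= /T linear0r addr0 subr0 expr0 mulr1 (seminormN hs).
  by apply: le_trans (Tlip _ _) _; rewrite exprS mulrCA ler_wpM2l// invr_ge0.
have [g ug] := rnorm_geometric_cvg a0 r01 du.
have Tg : T g = g.
  apply/eqP; rewrite -subr_eq0; apply/eqP; apply: rnorm_eq0.
  apply/ler_addgt0Pr => e e0; rewrite add0r.
  have e2 : 0 < e / 2 by rewrite divr_gt0.
  have [N _ hN] := ug _ e2.
  rewrite (_ : T g - g = (T g - T (u N)) + (u N.+1 - g)); last first.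
    by rewrite addrA subrK.
  apply: le_trans (seminormD hs _ _) _.
  have := hN _ (leqnn N); have := hN _ (leqnSn N); have := Tlip g (u N).
  rewrite -(seminormN hs (g - _)) opprB /=; lra.
have gE : g = - (a + mul a g) by rewrite -[LHS]Tg.
(* The commutator satisfies [h = - a h], which forces it to vanish. *)
have comm : mul a g = mul g a.
  have : mul a g - mul g a = - mul a (mul a g - mul g a).
    rewrite {1 2}gE linearNr linearNl linearDr linearDl linearBr /=.
    rewrite (banach_mulA hA a g a) opprK opprD addrACA addNr add0r.
    by rewrite opprB addrC.
  move=> /(congr1 (@rnorm R s A)); rewrite (seminormN hs) => h.
  apply/eqP; rewrite -subr_eq0; apply/eqP/rnorm_eq0.
  have := banach_norm_mul hA a (mul a g - mul g a); rewrite -h.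
  by have := rnorm_ge0 (mul a g - mul g a); nra.
exists g; split.
- rewrite unitization_mulE /uact /= mul1r !scale1r; congr (_, _).
  by rewrite -addrA [X in _ + X]addrC {1}gE addNr.
- rewrite unitization_mulE /uact /= mul1r !scale1r -comm; congr (_, _).
  by rewrite {2}gE subrr.
- have := banach_norm_mul hA a g; have := seminormD hs a (mul a g).
  rewrite -(seminormN hs (a + _)) -gE; have := rnorm_ge0 g; nra.
Qed.

Lemma unitization_scale_mul1 (l l' : scalars R s) (a g : A) :
  l * l' = 1 -> ((1, a) : U) * ((1, g) : U) = 1 ->
  ((l, l *: a) : U) * ((l', l' *: g) : U) = 1.
Proof.
move=> ll /(congr1 snd); rewrite !unitization_mulE /uact /= => ag.
rewrite linearZl_LR linearZr /= !scalerA [l' * l]mulrC ll.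
by rewrite (scale1r (mul a g)) ag.
Qed.

Definition cohen_factor (c : R) (e : A) : U :=
  (of_real s (1 - c), of_real s c *: e).

(** Dividing by [1 - c] turns the factor into [1 + a] with
    [rnorm a <= c d / (1 - c) <= 1/2]; the two bounds on [c] say just this and
    [(1 - c)^-1 <= 2]. The bound 4 is
    independent of [e], so it can enter the tolerance for which [e] is chosen. *)
Lemma cohen_factor_inverse (c d : R) (e : A) :
  0 <= c <= 2^-1 -> c * (2 * d + 1) <= 1 -> rnorm e <= d ->
  exists F : U, [/\ cohen_factor c e * F = 1, F * cohen_factor c e = 1
                  & usize F <= 4].
Proof.
move=> /andP[c0 c2] cd ed; have k0 : 0 < 1 - c by lra.
have kn0 : 1 - c != 0 by rewrite gt_eqF.
pose a := of_real s (c / (1 - c)) *: e.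
have e0 := rnorm_ge0 e.
have a2 : rnorm a <= 2^-1.
  rewrite /a (seminormZ (rnorm_seminorm A)) rnorm_of_real; last first.
    by rewrite divr_ge0// ltW.
  by rewrite mulrAC ler_pdivrMr//; nra.
have [g [ag ga g2]] := quasi_inverse a2.
have ll : of_real s (1 - c) * of_real s (1 - c)^-1 = 1.
  by rewrite -of_realM divff// of_real1.
have Ea : cohen_factor c e = (of_real s (1 - c), of_real s (1 - c) *: a).
  rewrite /cohen_factor /a scalerA -of_realM; congr (_, of_real s _ *: _).
  by rewrite mulrC divfK.
exists (of_real s (1 - c)^-1, of_real s (1 - c)^-1 *: g); split.
- by rewrite Ea; exact: unitization_scale_mul1.
- by rewrite Ea; apply: unitization_scale_mul1 => //; rewrite mulrC.
have k2 : (1 - c)^-1 <= 2 by rewrite invf_ple ?posrE//; lra.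
have k0' : 0 <= (1 - c)^-1 by rewrite invr_ge0 ltW.
rewrite /usize /= (seminormZ (rnorm_seminorm A)) rnorm_of_real//.
have := rnorm_ge0 g; nra.
Qed.

(** Apply [F] to [x - E x = c (x - e x)]. This is used both for the action on
    [L] and for the left multiplication of [A] on itself. *)
Lemma cohen_factor_inverse_sub (V : lmodType (scalars R s))
    (act : {bilinear A -> V -> V})
    (actA : forall a b x, act (mul a b) x = act a (act b x))
    (c : R) (e : A) (F : U) (x : V) : F * cohen_factor c e = 1 ->
  uact act F x - x = of_real s c *: uact act F (x - act e x).
Proof.
move=> FE; rewrite -uactZr.
have {2}-> : x = uact act F (uact act (cohen_factor c e) x).
  by rewrite -(uactM (mulA := banach_mulA hA) actA) FE; rewrite uact1.
rewrite -uactBr; congr (uact _ _ _).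
rewrite /uact /= linearZl_LR /= of_realD of_real1 of_realN scalerDl scale1r.
by rewrite scalerBr scaleNr -addrA opprD addrA subrr add0r opprD opprK.
Qed.

(** * Cohen's inductive step *)

Section Step.
Context (L : topologicalLmodType (scalars R s)) (act : {bilinear A -> L -> L}).
Context (p : nat -> L -> R) (hL : frechet_module mul act p).
Context (d : R) (hunit : left_bounded_approximate_unit mul act p d).

(** Taking [m >= n] lets one seminorm dominate both the scalar part and the
    algebra part of the action. *)
Lemma frechet_uact_bound n : exists (m : nat) (C : R), 0 <= C /\
  forall (u : U) x, p n (uact act u x) <= C * usize u * p m x.
Proof.
have hp := frechet_module_space hL.
have [C C1 /(_ n)[m hm]] := frechet_module_bound hL.
exists (maxn n m), C; split; first exact: le_trans C1.
apply: seminorm_uact => //; first exact: frechet_seminorm hp n.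
  by move=> x; apply: (frechet_increasing hp); exact: leq_maxl.
move=> a x; apply: le_trans (hm a x) _; rewrite ler_wpM2l//.
  by rewrite mulr_ge0 ?rnorm_ge0// (le_trans _ C1).
by apply: (frechet_increasing hp); exact: leq_maxr.
Qed.

(** The approximate unit restated with one seminorm in place of the metric, and
    with one element of [A], which is all that the inductive step uses. *)
Lemma approximate_unit_seminorm (a : A) (z : L) (m : nat) (r : R) : 0 < r ->
  exists e : A, [/\ rnorm e <= d, rnorm (a - mul e a) < r
                  & p m (z - act e z) < r].
Proof.
move=> r0; have hp := frechet_module_space hL.
have [r' r'0 hr'] := frechet_dist_controls hp m r0.
have [|e [ed ea ez]] := hunit [:: a] z (e := Num.min r r').
  by rewrite lt_min r0.
exists e; split => //.
  rewrite -(seminormN (rnorm_seminorm A)) opprB.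
  by have := ea a (mem_head _ _); rewrite lt_min => /andP[].
rewrite -(seminormN (frechet_seminorm hp m)) opprB.
by apply: hr'; move: ez; rewrite lt_min => /andP[].
Qed.

(** The new inverse is [(1 + g) S F], where [F] inverts the factor
    [(1 - c) + c e] and [1 + g] inverts [1 + S delta] with
    [delta = F a - a]. *)
Lemma cohen_step (c : R) (z : L) (lam : scalars R s) (a : A) (S : U)
    (N : nat) (eta : R) :
  0 <= c <= 2^-1 -> c * (2 * d + 1) <= 1 -> 0 < eta ->
  ((lam, a) : U) * S = 1 ->
  exists e S', [/\ rnorm e <= d,
    ((of_real s (1 - c) * lam, a + (lam * of_real s c) *: e) : U) * S' = 1
    & p N (uact act S' z - uact act S z) <= eta].
Proof.
move=> c01 cd eta0 TS1; have hp := frechet_module_space hL.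
have hs := frechet_seminorm hp N; have actA := frechet_module_actA hL.
have mulA' (x y v : A) : mul (mul x y) v = mul x (mul y v).
  by rewrite (banach_mulA hA).
have [m [C [C0 hC]]] := frechet_uact_bound N.
have S0 := usize_ge0 S; have z0 := seminorm_ge0 (frechet_seminorm hp m) z.
set sg := usize S in S0; set q := p m z in z0.
(* The smallness [tau] required of [a - e a] and [z - e z] has to serve twice:
   [8 sg tau <= 1] makes [S delta] small enough to be inverted, and the rest of
   [D] bounds the displacement of [S z]. *)
pose D := 8 * sg + C * (32 * sg ^+ 2 * q + 4 * sg) + 1.
have K0 : 0 <= C * (32 * sg ^+ 2 * q + 4 * sg).
  by rewrite mulr_ge0// addr_ge0 ?mulr_ge0// exprn_ge0.
have D0 : 0 < D by rewrite /D; lra.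
pose tau := Num.min eta 1 / D.
have tau0 : 0 < tau by rewrite divr_gt0// lt_min eta0 ltr01.
have tauD : tau * D = Num.min eta 1 by rewrite /tau divfK// gt_eqF.
have tau_eta : tau * (C * (32 * sg ^+ 2 * q + 4 * sg)) <= eta.
  apply: (@le_trans _ _ (tau * D)); last by rewrite tauD ge_min lexx.
  by rewrite ler_pM2l// /D; lra.
have tau_half : sg * (4 * tau) <= 2^-1.
  have : tau * (8 * sg) <= 1; last by nra.
  apply: (@le_trans _ _ (tau * D)); last by rewrite tauD ge_min lexx orbT.
  by rewrite ler_pM2l// /D; lra.
have [e [ed ea ez]] := approximate_unit_seminorm a z m tau0.
have [F [EF FE F4]] := cohen_factor_inverse c01 cd ed.
have F0 := usize_ge0 F.
have [c0 c1] : 0 <= c /\ c <= 1 by lra.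
pose delta := uact mul F a - a.
have delta_le : rnorm delta <= 4 * tau.
  rewrite /delta (cohen_factor_inverse_sub mulA' _ FE).
  rewrite (seminormZ (rnorm_seminorm A)) rnorm_of_real//.
  have := rnorm_uact F (a - mul e a).
  have := rnorm_ge0 (a - mul e a); have := rnorm_ge0 (uact mul F (a - mul e a)).
  nra.
pose w := uact mul S delta.
have w_le : rnorm w <= sg * (4 * tau).
  by apply: le_trans (rnorm_uact S delta) _; rewrite ler_wpM2l.
have [g [wg _ g_le]] := quasi_inverse (le_trans w_le tau_half).
have TwE : ((lam, a) : U) * ((1, w) : U) = (lam, uact mul F a).
  rewrite unitization_mulE /= mulr1 scale1r; congr (_, _).
  rewrite /w -(uactM (mulA := banach_mulA hA) mulA') TS1 uact1.
  by rewrite /delta subrK.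
have EuE : cohen_factor c e * ((lam, uact mul F a) : U) =
    (of_real s (1 - c) * lam, a + (lam * of_real s c) *: e).
  rewrite unitization_mulE /= -(uactM (mulA := banach_mulA hA) mulA').
  by rewrite EF uact1 scalerA.
exists e, (((1, g) : U) * S * F); split=> //.
  rewrite -EuE -TwE -!mulrA (mulrA ((1, w) : U)) wg mul1r.
  by rewrite (mulrA _ S F) TS1 mul1r.
have g_split x : uact act ((1, g) : U) x = x + uact act ((0, g) : U) x.
  by rewrite /uact /= scale1r scale0r add0r.
(* [S' z - S z = S (F z - z) + g S F z], two terms estimated separately. *)
rewrite -mulrA (uactM (mulA := banach_mulA hA) actA) g_split.
rewrite {1}(uactM (mulA := banach_mulA hA) actA) addrAC -uactBr.
rewrite (cohen_factor_inverse_sub actA _ FE) uactZr.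
rewrite -!(uactM (mulA := banach_mulA hA) actA).
apply: le_trans (seminormD hs _ _) _; rewrite (seminormZ hs) rnorm_of_real//.
have SF_le := usizeM S F; have gSF_le := usizeM ((0, g) : U) (S * F).
have g_size : usize ((0, g) : U) = rnorm g.
  by rewrite /usize /= -(of_real0 R s) rnorm_of_real// add0r.
have SF4 : usize (S * F) <= sg * 4.
  by apply: le_trans SF_le _; rewrite ler_wpM2l.
have h1 : p N (uact act (S * F) (z - act e z)) <= C * (sg * 4) * tau.
  apply: le_trans (hC _ _) _; apply: ler_pM => //.
  - by rewrite mulr_ge0// usize_ge0.
  - exact: seminorm_ge0 (frechet_seminorm hp m) _.
  - by rewrite ler_wpM2l.
  - exact: ltW.
have h2 : p N (uact act (((0, g) : U) * (S * F)) z) <=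
    C * (2 * (sg * (4 * tau)) * (sg * 4)) * q.
  apply: le_trans (hC _ _) _; rewrite ler_wpM2r// ler_wpM2l//.
  apply: le_trans gSF_le _; rewrite g_size ler_pM ?rnorm_ge0 ?usize_ge0//.
  by apply: le_trans g_le _; rewrite ler_wpM2l.
have h3 := seminorm_ge0 hs (uact act (S * F) (z - act e z)).
apply: le_trans tau_eta; apply: (@le_trans _ _ (C * (sg * 4) * tau +
  C * (2 * (sg * (4 * tau)) * (sg * 4)) * q)); last first.
  by rewrite le_eqVlt; apply/orP; left; apply/eqP; ring.
by rewrite lerD//; apply: le_trans h1; rewrite ler_piMl.
Qed.

End Step.

End BanachAlgebra.

(** * Iteration and passage to the limit *)

Section Factorization.
Context (R : realType) (s : scalar_kind).
Context (A : completeNormedModType (scalars R s)).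
Context (mul : {bilinear A -> A -> A}) (hA : banach_algebra mul).
Local Notation U := (unitization (banach_mulA hA)).
Context (L : topologicalLmodType (scalars R s)) (act : {bilinear A -> L -> L}).
Context (p : nat -> L -> R) (hL : frechet_module mul act p).
Context (d : R) (hunit : left_bounded_approximate_unit mul act p d).

(** Shifting the seminorm index by [N] makes the first increments small for the
    seminorm of index [N], which governs the distance from the limit to [z]. *)
Lemma cohen_sequence (c eta : R) (z : L) (N : nat) :
  0 <= c <= 2^-1 -> c * (2 * d + 1) <= 1 -> 0 < eta ->
  exists (a : nat -> A) (S : nat -> U), [/\ a 0%N = 0, S 0%N = 1
   & forall n, [/\ ((of_real s ((1 - c) ^+ n), a n) : U) * S n = 1,
       rnorm (a n.+1 - a n) <= c * d * (1 - c) ^+ n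
     & p (N + n) (uact act (S n.+1) z - uact act (S n) z) <= eta * 2^-1 ^+ n]].
Proof.
move=> c01 cd eta0; have [c0 c1] : 0 <= c /\ c <= 1 by lra.
pose inv n (v : A * U) := ((of_real s ((1 - c) ^+ n), v.1) : U) * v.2 = 1.
pose near_next n (v v' : A * U) := rnorm (v'.1 - v.1) <= c * d * (1 - c) ^+ n /\
  p (N + n) (uact act v'.2 z - uact act v.2 z) <= eta * 2^-1 ^+ n.
(* Under an implication, so that the choice function is total on states. *)
have step (nv : nat * (A * U)) : exists v', inv nv.1 nv.2 ->
    inv nv.1.+1 v' /\ near_next nv.1 nv.2 v'.
  case: nv => n v; have [vinv|] := pselect (inv n v); last by exists v.
  have en : 0 < eta * 2^-1 ^+ n by rewrite mulr_gt0// exprn_gt0.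
  have [e [S' [ed TS' S'z]]] := cohen_step hL hunit z (N + n) c01 cd en vinv.
  exists (v.1 + (of_real s ((1 - c) ^+ n) * of_real s c) *: e, S') => _ /=.
  rewrite /inv /near_next /= exprS of_realM; split=> //; split=> //.
  rewrite addrC addKr (seminormZ (rnorm_seminorm A)) -of_realM rnorm_of_real.
    rewrite mulrC [_ * c]mulrC mulrA ler_wpM2r ?exprn_ge0 ?subr_ge0//.
    by rewrite mulrC ler_wpM2l.
  by rewrite mulr_ge0// exprn_ge0// subr_ge0.
have [f hf] := choice step.
pose v := fix v n : A * U := if n is m.+1 then f (m, v m) else (0, 1).
have vinv n : inv n (v n).
  elim: n => [|n IH]; last by have [] := hf (n, v n) IH.
  by rewrite /inv /= mulr1 expr0 of_real1.
exists (fun n => (v n).1), (fun n => (v n).2); split=> // n.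
by have [_ [an un]] := hf (n, v n) (vinv n); split; first exact: vinv n.
Qed.

(** Approximate [z] by [e z] with [e] from the approximate unit: [S k (e z)] is
    in [A z] because [A] is an ideal of its unitization. *)
Lemma uact_in_closure (z y : L) (S : nat -> U) :
  (forall n e, 0 < e -> \forall k \near \oo, p n (uact act (S k) z - y) < e) ->
  closure [set act mu z | mu in [set: A]] y.
Proof.
move=> Sz B; have hp := frechet_module_space hL.
move=> /(frechet_nbhs hp) [n [e e0 sB]].
have hs := frechet_seminorm hp n.
have e2 : 0 < e / 2 by rewrite divr_gt0.
have [k _ /(_ k (leqnn k)) hk] := Sz n _ e2.
have [m [C [C0 hC]]] := frechet_uact_bound hA hL n.
have K0 : 0 <= C * usize (S k) by rewrite mulr_ge0// usize_ge0.
have K1 : 0 < C * usize (S k) + 1 by rewrite ltr_wpDl.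
have r0 : 0 < e / 2 / (C * usize (S k) + 1) by rewrite divr_gt0.
have [mu [_ _ hmu]] := approximate_unit_seminorm hL hunit 0 z m r0.
exists (act (uact mul (S k) mu) z); split; first by exists (uact mul (S k) mu).
have -> : act (uact mul (S k) mu) z = uact act (S k) (act mu z).
  by rewrite /uact linearDl linearZl_LR /= (frechet_module_actA hL).
apply: sB => /=; rewrite (_ : y - _ =
  (y - uact act (S k) z) + uact act (S k) (z - act mu z)); last first.
  by rewrite uactBr addrA subrK.
apply: le_lt_trans (seminormD hs _ _) _.
rewrite -(seminormN hs (y - _)) opprB [ltRHS](splitr e) ltr_leD//.
apply: le_trans (hC _ _) _.
apply: (@le_trans _ _ (C * usize (S k) * (e / 2 / (C * usize (S k) + 1)))).
  by rewrite ler_wpM2l// ltW.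
by rewrite mulrCA ler_piMr ?(ltW e2)// ler_pdivrMr// mul1r lerDl.
Qed.

(** Pass to the limit in [z = lam_n u_n + a_n u_n]; the [u n] stay bounded
    for each seminorm because they converge. *)
Lemma limit_factorization (z y : L) (sigma : A) (lam : nat -> R)
    (a : nat -> A) (u : nat -> L) :
  (forall n, 0 <= lam n) ->
  (forall e, 0 < e -> \forall n \near \oo, lam n < e) ->
  (forall e, 0 < e -> \forall n \near \oo, rnorm (a n - sigma) < e) ->
  (forall m e, 0 < e -> \forall n \near \oo, p m (u n - y) < e) ->
  (forall n, uact act (of_real s (lam n), a n) (u n) = z) ->
  z = act sigma y.
Proof.
move=> lam0 hlam ha hu uz; have hp := frechet_module_space hL.
apply/eqP; rewrite -subr_eq0; apply/eqP/(frechet_eq0 hp) => n.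
have hs := frechet_seminorm hp n.
apply/le_anti; rewrite (seminorm_ge0 hs) andbT.
apply/ler_addgt0Pr => e e0; rewrite add0r.
have [m [C [C0 hC]]] := frechet_uact_bound hA hL n.
have hm := frechet_seminorm hp m.
have y0 := seminorm_ge0 hm y; have s0 := rnorm_ge0 sigma.
pose K := C * (2 * (p m y + 1) + rnorm sigma).
have K0 : 0 <= K by rewrite /K mulr_ge0//; lra.
have K1 : 0 < K + 1 by rewrite ltr_wpDl.
pose r := e / (K + 1); have r0 : 0 < r by rewrite divr_gt0.
have r1 : 0 < Num.min r 1 by rewrite lt_min r0 ltr01.
have [k _ /(_ k (leqnn k))[[lk ak]]] :=
  filterI (filterI (hlam _ r0) (ha _ r0)) (hu m _ r1).
rewrite lt_min => /andP[ukr uk1].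
have -> : z - act sigma y = uact act (of_real s (lam k), a k - sigma) (u k)
    + uact act (0, sigma) (u k - y).
  rewrite -(uz k) /uact /= scale0r add0r linearBl linearBr /=.
  by rewrite -!addrA (addrA (- act sigma (u k))) addNr add0r.
apply: le_trans (seminormD hs _ _) _.
have u_le : p m (u k) <= p m y + 1.
  rewrite -[u k](subrK y); apply: le_trans (seminormD hm _ _) _.
  by rewrite addrC lerD2l ltW.
have h1 := hC (of_real s (lam k), a k - sigma) (u k).
have h2 := hC (0, sigma) (u k - y).
apply: le_trans (lerD h1 h2) _; rewrite /usize /= rnorm_of_real//.
rewrite -(of_real0 R s) rnorm_of_real// add0r -!mulrA -mulrDr.
apply: (@le_trans _ _ (C * (2 * r * (p m y + 1) + rnorm sigma * r))).
  rewrite ler_wpM2l// lerD//; last by rewrite ler_wpM2l// ltW.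
  apply: ler_pM => //; last by lra.
    by rewrite addr_ge0// rnorm_ge0.
  exact: seminorm_ge0 hm _.
rewrite (_ : C * _ = K * r); last by rewrite /K; ring.
by rewrite /r mulrCA ler_piMr ?(ltW e0)// ler_pdivrMr// mul1r lerDl.
Qed.

End Factorization.

Theorem theorem2p4 (R : realType) (s : scalar_kind)
    (A : completeNormedModType (scalars R s)) (mul : {bilinear A -> A -> A})
    (hA : banach_algebra mul)
    (L : topologicalLmodType (scalars R s)) (act : {bilinear A -> L -> L})
    (p : nat -> L -> R) (hL : frechet_module mul act p)
    (d : R) (hd : 0 < d)
    (hunit : left_bounded_approximate_unit mul act p d)
    (z : L) (eps : R) (heps : 0 < eps) :
  exists (sigma : A) (y : L),
    [/\ z = act sigma y,
        closure [set act mu z | mu in [set: A]] y,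
        frechet_dist p y z <= eps
      & rnorm sigma <= d].
Proof.
have hp := frechet_module_space hL; have hs := rnorm_seminorm A.
have half01 : 0 <= (2^-1 : R) < 1 by apply/andP; split; lra.
have [N _ /(_ N (leqnn N)) hN] : \forall n \near \oo, 1 * 2^-1 ^+ n < eps / 2.
  by apply: geometric_lt => //; rewrite divr_gt0.
(* Any positive [c <= 1/2] with [c (2 d + 1) <= 1] would do. *)
pose c := (2 * d + 2)^-1.
have d2 : 0 < 2 * d + 2 by lra.
have c0 : 0 < c by rewrite invr_gt0.
have cE : c * (2 * d + 2) = 1 by rewrite mulVf// gt_eqF.
have cd : c * (2 * d + 1) <= 1 by nra.
have c2 : c <= 2^-1 by nra.
have c01 : 0 <= c <= 2^-1 by rewrite ltW.
(* Increments at most [eps / 4 * 2 ^- n] add up to [eps / 2]; the tail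
   [2 ^- N < eps / 2] of the metric makes up the rest. *)
have eta0 : 0 < eps / 4 by rewrite divr_gt0.
have [a [S [a0 S0 /all_and3[TS da du]]]] :=
  cohen_sequence hA hL hunit z N c01 cd eta0.
have q01 : 0 <= 1 - c < 1 by apply/andP; split; lra.
have cd0 : 0 <= c * d by rewrite mulr_ge0// ltW.
have [sigma a_sigma] := rnorm_geometric_cvg cd0 q01 da.
have [y yz u_y] := frechet_geometric_cvg (u := fun n => uact act (S n) z) hp
  (ltW eta0) half01 du.
exists sigma, y; split.
- apply: (limit_factorization hA hL (lam := fun n => (1 - c) ^+ n) _ _ a_sigma u_y).
  + by move=> n; rewrite exprn_ge0//; lra.
  + move=> e e0; have := geometric_lt 1 q01 e0.
    by apply: filterS => n; rewrite mul1r.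
  + move=> n; rewrite -(uactM (mulA := banach_mulA hA) (frechet_module_actA hL)).
    by rewrite TS uact1.
- exact: (uact_in_closure (hA := hA) hL hunit u_y).
- apply: le_trans (frechet_dist_le hp y z N) _.
  move: yz; rewrite S0 uact1 => yz.
  move: hN; rewrite mul1r exprVn => hN.
  have : eps / 4 / (1 - 2^-1) = eps / 2 by field.
  lra.
- apply/ler_addgt0Pr => e e0.
  have [k _ /(_ k (leqnn k)) hk] := a_sigma e e0.
  have ak : rnorm (a k) <= d.
    have := seminorm_telescope (N := 0) hs cd0 q01 (fun n _ => da n)
      (i := 0) (j := k) isT.
    rewrite a0 subr0 expr0 mulr1 opprB addrC subrK mulrAC divff ?mul1r//.
    by rewrite gt_eqF.
  rewrite -(subrK (a k) sigma) addrC.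
  apply: le_trans (seminormD hs _ _) _; rewrite lerD//.
  by rewrite -(seminormN hs) opprB ltW.
Qed.
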